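(* Let $Y$ and $\psi$ be real-valued random variables with $\mathbb{E}(|Y|)<\infty$ and $\mathbb{E}(|\psi|)<\infty$, and suppose that $Y$ and $\psi$ satisfy $\mathrm{H}_0$. Let $\varepsilon=Y-\psi$. Let $\widehat{\psi}=\psi+\xi_\psi$ with $\xi_\psi$ independent of $\psi$ and $\mathbb{E}[\xi_\psi]=0$, and $\widehat{Y}=Y+\xi_Y$ with $\xi_Y$ independent of $Y$ and $\mathbb{E}[\xi_Y]=0$. Suppose also that $\varepsilon+\xi_Y$ is independent of $\psi$ and that $F_{\xi_\psi}$ dominates at the second order $F_{\xi_Y+\varepsilon}$. Then $\widehat{Y}$ and $\widehat{\psi}$ satisfy $\mathrm{H}_0$.
   Context: For a random variable $Z$, $F_Z$ denotes its cumulative distribution function. Two random variables $Y,\psi$ are said to satisfy $\mathrm{H}_0$ if there exist a pair of random variables $(Y',\psi')$ (on some probability space) and a sigma-algebra $\mathcal{I}'$ such that $\sigma(\psi')\subset\mathcal{I}'$, $Y'\sim Y$, $\psi'\sim\psi$ and $\mathbb{E}[Y'|\mathcal{I}']=\psi'$, where $\sim$ denotes equality in distribution. A cdf $F$ dominates a cdf $G$ at the second order if $\int_{-\infty}^{t}F(u)\,du\leq\int_{-\infty}^{t}G(u)\,du$ for all $t\in\mathbb{R}$. *)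

(* Defs.v *)
From HB Require Import structures.
From mathcomp Require Import all_boot all_order all_algebra.
From mathcomp Require Import all_classical all_reals all_analysis.
From mathcomp Require Import measurable_realfun.

Set Implicit Arguments.
Unset Strict Implicit.
Unset Printing Implicit Defensive.

Import Order.TTheory GRing.Theory Num.Theory.
Import numFieldNormedType.Exports.

Local Open Scope classical_set_scope.
Local Open Scope ring_scope.
Local Open Scope ereal_scope.

Definition sigma_rv d (T : measurableType d) (R : realType)
    (P : probability T R) (X : {RV P >-> R}) : set (set T) :=
  preimage_set_system [set: T] X measurable.

Definition eq_distribution d1 (T1 : measurableType d1) d2
    (T2 : measurableType d2) (R : realType) (P1 : probability T1 R)
    (P2 : probability T2 R) (X1 : {RV P1 >-> R}) (X2 : {RV P2 >-> R}) : Prop :=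
  forall A : set R, measurable A -> distribution P1 X1 A = distribution P2 X2 A.

Definition independent_rv d (T : measurableType d) (R : realType)
    (P : probability T R) (X Y : {RV P >-> R}) : Prop :=
  forall A B : set R, measurable A -> measurable B ->
    P (X @^-1` A `&` Y @^-1` B) = P (X @^-1` A) * P (Y @^-1` B).

Definition sub_sigma_algebra d (T : measurableType d) (I : set (set T)) : Prop :=
  sigma_algebra [set: T] I /\ I `<=` measurable.

(* E[X | I] = Z.  Conditional expectations are defined up to P-null sets, so
   this is a relation: Z is a version of E[X | I]. *)
Definition is_condexp d (T : measurableType d) (R : realType)
    (P : probability T R) (I : set (set T)) (X Z : {RV P >-> R}) : Prop :=
  [/\ P.-integrable [set: T] (EFin \o X),
      P.-integrable [set: T] (EFin \o Z),
      sigma_rv Z `<=` I &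
      forall A, I A -> \int[P]_(x in A) (Z x)%:E = \int[P]_(x in A) (X x)%:E].

(* This only depends on the marginal laws of Y and psi, which may therefore
   live on different probability spaces. *)
Definition satisfy_H0 d1 (T1 : measurableType d1) d2 (T2 : measurableType d2)
    (R : realType) (P1 : probability T1 R) (P2 : probability T2 R)
    (Y : {RV P1 >-> R}) (psi : {RV P2 >-> R}) : Prop :=
  exists (d : measure_display) (T : measurableType d) (P : probability T R)
         (Y' psi' : {RV P >-> R}) (I : set (set T)),
    [/\ sub_sigma_algebra I,
        sigma_rv psi' `<=` I,
        eq_distribution Y' Y,
        eq_distribution psi' psi &
        is_condexp I Y' psi'].

Definition second_order_dominates (R : realType) (F G : R -> \bar R) : Prop :=
  forall t : R, \int[lebesgue_measure]_(u in `]-oo, t]) F u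
             <= \int[lebesgue_measure]_(u in `]-oo, t]) G u.

(* Main.v *)
(** Put [W = eps + xi_Y]: then [hat_Y = psi + W] and [hat_psi = psi + xi_psi],
    with [psi] independent of both [W] and [xi_psi], so it suffices to couple the
    laws [mu] of [xi_psi] and [nu] of [W] by a martingale [(X, Z)] (Strassen's
    theorem on the line) and to add an independent copy of [psi] to both.

    The coupling is a variant of the inverse transform martingale coupling of
    Jourdain and Margheriti.  Let [f], [g] be the quantile functions of [mu],
    [nu] on (0, 1).  The convex order says that [f - g] has nonnegative
    primitive, vanishing at 1; hence if [a], [b] are the quantile functions of
    the measures [(f - g)^+ du] and [(g - f)^+ du] then [a <= b].  Starting
    from the law of [(f, g)], one exchanges mass between the second coordinates
    at [a s] and at [b s], at rate [ds / (g (b s) - g (a s))].  This leaves both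
    marginals unchanged, it makes the coupling a martingale, and there is enough
    mass because [g (a s) < f (a s) <= f (b s) < g (b s)]. *)

Require Import Defs.
From HB Require Import structures.
From mathcomp Require Import all_boot all_order all_algebra.
From mathcomp Require Import all_classical all_reals all_analysis.
From mathcomp Require Import measurable_realfun.
From mathcomp Require Import ring lra.

Import Order.TTheory GRing.Theory Num.Theory.
Import numFieldNormedType.Exports.

Local Open Scope classical_set_scope.
Local Open Scope ring_scope.

Import HBNNSimple.

(** * Images of weighted measures, uniqueness on rays, quantile functions *)

(** [m] is the image under [phi] of the measure with density [w]. The formula holds for simple
    functions by linearity and in general by monotone convergence. All pieces of the coupling are
    built this way and are handled through this formula alone. *)
Lemma density_image_exists (R : realType) d1 d2 (T1 : measurableType d1)
    (T2 : measurableType d2) (mu : {measure set T1 -> \bar R})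
    (w : T1 -> R) (phi : T1 -> T2) :
  measurable_fun setT w -> (forall x, 0 <= w x) -> measurable_fun setT phi ->
  exists m : {measure set T2 -> \bar R}, forall F : T2 -> \bar R,
    measurable_fun setT F -> (forall y, (0 <= F y)%E) ->
    (\int[m]_y F y = \int[mu]_x ((w x)%:E * F (phi x)))%E.
Proof.
move=> mw w0 mphi.
have mpre A : measurable A -> measurable (phi @^-1` A).
  by move=> mA; rewrite -[X in measurable X]setTI; exact: mphi.
have mEw : measurable_fun setT (EFin \o w) by exact/measurable_EFinP.
pose nu (A : set T2) : \bar R := (\int[mu]_(x in phi @^-1` A) (w x)%:E)%E.
have nu0 : nu set0 = 0%E by rewrite /nu preimage_set0 integral_set0.
have nuge0 A : (0 <= nu A)%E by apply: integral_ge0 => x _; rewrite lee_fin.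
have nuadd : semi_sigma_additive nu.
  move=> F mF tF mUF.
  rewrite /nu preimage_bigcup.
  apply: (@semi_sigma_additive_nng_induced _ _ _ mu (EFin \o w)) => //.
  - by move=> i; exact: mpre.
  - by move=> i j _ _ [x [Fix Fjx]]; apply: tF => //; exists (phi x).
  - by rewrite -preimage_bigcup; exact: mpre.
pose m : {measure set T2 -> \bar R} :=
  HB.pack nu (isMeasure.Build _ _ _ nu nu0 nuge0 nuadd).
exists m => F mF F0.
pose f_ := nnsfun_approx measurableT mF.
have cvf y : (f_ n y)%:E @[n --> \oo] --> F y.
  by apply: cvg_nnsfun_approx => // *; exact: F0.
transitivity (limn (fun n => \int[m]_x (f_ n x)%:E))%E.
  rewrite -monotone_convergence//.
  - by apply: eq_integral => y _; apply/esym/cvg_lim => //; exact: cvf.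
  - by move=> n; exact/measurable_EFinP/measurable_funP.
  - by move=> n y _; rewrite lee_fin; exact: fun_ge0.
  - by move=> y _ a b ab; rewrite lee_fin; exact/lefP/nd_nnsfun_approx.
rewrite [X in limn X](_ : _ =
    (fun n => \int[mu]_x ((w x)%:E * (f_ n (phi x))%:E)))%E; last first.
  apply/funext => n.
  rewrite integralT_nnsfun sintegralE.
  transitivity (\sum_(k \in range (f_ n))
    \int[mu]_x (k * \1_(f_ n @^-1` [set k]) (phi x) * w x)%:E)%E.
    apply: eq_fsbigr => r; rewrite inE => -[y _ fyr].
    have r0 : 0 <= r by rewrite -fyr; exact: fun_ge0.
    under eq_integral do rewrite -mulrA EFinM.
    rewrite ge0_integralZl//; last 2 first.
    - apply/measurable_EFinP/measurable_funM => //.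
      by apply: measurableT_comp.
    - by move=> x _; rewrite lee_fin mulr_ge0.
    congr (_ * _)%E; rewrite /m/= /nu integral_mkcond.
    apply: eq_integral => x _.
    rewrite /patch/= indicE.
    have -> : (x \in phi @^-1` (f_ n @^-1` [set r])) =
        (phi x \in f_ n @^-1` [set r]) by apply/idP/idP; rewrite !inE.
    by case: ifPn => _; rewrite ?mul1r ?mul0r.
  rewrite -ge0_integral_fsum//.
  - apply: eq_integral => x _.
    rewrite fsumEFin// -EFinM; congr EFin.
    rewrite [in RHS]fimfunE mulrC mulr_fsuml//.
  - move=> r; apply/measurable_EFinP/measurable_funM => //.
    by apply: measurable_funM => //; apply: measurableT_comp.
  - move=> r x _; rewrite lee_fin mulr_ge0//.
    exact: nnfun_muleindic_ge0.
rewrite -monotone_convergence//.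
- apply: eq_integral => x _; apply/cvg_lim => //.
  by apply: cvgeZl.
- move=> n; apply: emeasurable_funM => //.
  by apply/measurable_EFinP; apply: measurableT_comp.
- by move=> n x _; rewrite mule_ge0// lee_fin.
- move=> x _ a b ab; rewrite lee_wpmul2l ?lee_fin//.
  exact/lefP/nd_nnsfun_approx.
Qed.

(** The rays []x, +oo[] generate the Borel sets and are stable under intersection; for finite
    measures their masses are the total mass minus that of []-oo, x]]. *)
Lemma measure_ray_unique (R : realType) (m1 m2 : {measure set R -> \bar R}) :
  (m1 setT < +oo)%E -> m1 setT = m2 setT ->
  (forall x : R, m1 `]-oo, x]%classic = m2 `]-oo, x]%classic) ->
  forall A, measurable A -> m1 A = m2 A.
Proof.
move=> m1fin m12T m12 A mA.
have rayC (m : {measure set R -> \bar R}) (x : R) : (m setT < +oo)%E ->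
    m `]x, +oo[%classic = (m setT - m `]-oo, x]%classic)%E.
  by move=> mfin; rewrite -setCitvl -setTD measureD// setTI.
have m2fin : (m2 setT < +oo)%E by rewrite -m12T.
apply: (measure_unique (@RGenOInfty.G R) (fun n => `](- n%:R)%R, +oo[%classic)) => //.
- exact: RGenOInfty.measurableE.
- move=> _ _ [x ->] [y ->]; exists (Num.max x y).
  by apply/seteqP; split=> z /=; rewrite !in_itv/= !andbT gt_max => /andP.
- by move=> n; exists (- n%:R).
- rewrite -subTset => x _; exists (Num.bound (- x)) => //=.
  by rewrite in_itv/= andbT ltrNl unstable.ltr_bound.
- by move=> _ [x ->]; rewrite !rayC// m12T m12.
- move=> n; apply: le_lt_trans m1fin.
  by apply: le_measure; rewrite ?inE.
Qed.

(** The generalized inverse of the distribution function carries Lebesgue measure on []0, M[] to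
    [m]. The mass [M] is arbitrary because the lemma serves both for probability laws and for the
    measures with densities [(f - g)^+] and [(g - f)^+]. *)
Lemma quantile_exists (R : realType) (m : {measure set R -> \bar R}) (M : R) :
  m setT = M%:E ->
  exists q : R -> R, [/\ measurable_fun setT q,
    forall u x, 0 < u -> u < M -> (q u <= x) = (u%:E <= m `]-oo, x]%classic)%E &
    forall F : R -> \bar R, measurable_fun setT F -> (forall y, (0 <= F y)%E) ->
      (\int[m]_y F y =
       \int[lebesgue_measure]_u ((\1_(`]0%R, M[%classic) u)%:E * F (q u)))%E].
Proof.
move=> mM.
have mle A B : measurable A -> measurable B -> A `<=` B -> (m A <= m B)%E.
  by move=> mA mB AB; apply: le_measure; rewrite ?inE.
have mfin A : measurable A -> m A \is a fin_num.
  move=> mA; rewrite ge0_fin_numE//; apply: (@le_lt_trans _ _ (m setT)).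
    exact: mle.
  by rewrite mM ltry.
pose F x := fine (m `]-oo, x]%classic).
have FE x : m `]-oo, x]%classic = (F x)%:E by rewrite fineK// mfin.
have Fnd x y : x <= y -> F x <= F y.
  move=> xy; rewrite -lee_fin -!FE; apply: mle => //.
  by apply: subset_itvl; rewrite bnd_simp.
have F0 x : 0 <= F x by rewrite -lee_fin -FE.
have FM x : F x <= M by rewrite -lee_fin -FE -mM; apply: mle.
(* Right continuity of [F], in the form that makes the infimum defining [q u] attained. *)
have Fr (x u : R) : (forall n, u <= F (x + n.+1%:R^-1)) -> u <= F x.
  move=> h; rewrite -lee_fin -FE.
  have -> : `]-oo, x]%classic = \bigcap_n `]-oo, (x + n.+1%:R^-1)%R]%classic.
    by rewrite -itvNycEbigcap.
  have cv : m `]-oo, (x + n.+1%:R^-1)%R]%classic @[n --> \oo] -->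
      m (\bigcap_n `]-oo, (x + n.+1%:R^-1)%R]%classic).
    apply: nonincreasing_cvg_mu => //.
    - by rewrite ltey_eq mfin.
    - exact: bigcap_measurable.
    - move=> a b ab; apply/subsetPset; apply: subset_itvl.
      by rewrite bnd_simp lerD2l lef_pV2 ?posrE// ler_nat.
  rewrite -(cvg_lim _ cv)//; apply: lime_ge.
    by apply/cvg_ex; eexists; exact: cv.
  by apply: nearW => n; rewrite FE lee_fin.
(* By the limits of [F] at both infinities (here and in [FNy]), the set of [x] with [u <= F x] is
   nonempty and bounded below when [0 < u < M]. *)
have Fy u : u < M -> exists x, u <= F x.
  move=> uM; apply: contrapT => /forallNP h.
  have cv : m `]-oo, n%:R]%classic @[n --> \oo] --> m (\bigcup_n `]-oo, n%:R]%classic).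
    apply: nondecreasing_cvg_mu => //; first exact: bigcup_measurable.
    move=> a b ab; apply/subsetPset; apply: subset_itvl.
    by rewrite bnd_simp ler_nat.
  suff : (M%:E <= u%:E)%E by rewrite lee_fin leNgt uM.
  rewrite -mM; have -> : [set: R] = \bigcup_n `]-oo, n%:R]%classic.
    apply/esym; rewrite -subTset => x _; exists (Num.bound x) => //=.
    by rewrite in_itv/= ltW// unstable.ltr_bound.
  rewrite -(cvg_lim _ cv)//; apply: lime_le.
    by apply/cvg_ex; eexists; exact: cv.
  apply: nearW => n; rewrite FE lee_fin ltW// ltNge; exact/negP.
have FNy (u : R) : 0 < u -> exists x, F x < u.
  move=> u0; apply: contrapT => /forallNP h.
  have cv : m `]-oo, (- n%:R)%R]%classic @[n --> \oo] -->
      m (\bigcap_n `]-oo, (- n%:R)%R]%classic).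
    apply: nonincreasing_cvg_mu => //.
    - by rewrite ltey_eq mfin.
    - exact: bigcap_measurable.
    - move=> a b ab; apply/subsetPset; apply: subset_itvl.
      by rewrite bnd_simp lerN2 ler_nat.
  suff : (u%:E <= m (\bigcap_n (`]-oo, (- n%:R)%R]%classic : set R)))%E.
    rewrite (_ : \bigcap_n _ = set0) ?measure0 ?lee_fin ?leNgt ?u0//.
    rewrite -subset0 => t /(_ (Num.bound (- t)) I)/=.
    by rewrite in_itv/= leNgt => /negP; apply; rewrite ltrNl unstable.ltr_bound.
  rewrite -(cvg_lim _ cv)//; apply: lime_ge.
    by apply/cvg_ex; eexists; exact: cv.
  apply: nearW => n; rewrite FE lee_fin leNgt; exact/negP.
pose q u := inf [set x | u <= F x].
have qP u x : 0 < u -> u < M -> (q u <= x) = (u <= F x).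
  move=> u0 uM.
  have hi : has_inf [set x | u <= F x].
    split; first by have [y uy] := Fy _ uM; exists y.
    have [y yu] := FNy _ u0; exists y => z /= uz; rewrite leNgt.
    by apply/negP => /ltW/Fnd Fzy; move: (lt_le_trans yu (le_trans uz Fzy)); rewrite ltxx.
  apply/idP/idP => [qx|ux]; last by apply: ge_inf => //; case: hi.
  apply: Fr => n.
  have [|y /= uy yx] := @inf_adherent _ [set x | u <= F x] n.+1%:R^-1 _ hi.
    by rewrite invr_gt0.
  by apply: (le_trans uy); apply: Fnd; apply: (le_trans (ltW yx)); rewrite lerD2r.
have qlt u x : 0 < u -> u < M -> (x < q u) = (F x < u).
  by move=> u0 uM; rewrite !ltNge qP.
have mq0 : measurable_fun (`]0%R, M[%classic : set R) q.
  apply: (measurability (@RGenOInfty.G R)); first exact: RGenOInfty.measurableE.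
  move=> _ [_ [x ->] <-].
  rewrite (_ : _ `&` _ = `]0, M[%classic `&` `]F x, +oo[%classic).
    exact: measurableI.
  apply/seteqP; split => u /= []; rewrite !in_itv/= !andbT => /andP[u0 uM];
    by rewrite u0 uM qlt //; split.
(* The infimum is a quantile only for [u] in []0, M[]; cutting [q] off elsewhere gives a function
   measurable on the whole line. *)
pose q' := q \_ (`]0%R, M[%classic : set R).
have q'E u : 0 < u -> u < M -> q' u = q u.
  by move=> u0 uM; rewrite /q' /patch mem_set//= in_itv/= u0 uM.
have mq' : measurable_fun setT q'.
  by apply: (iffLR (measurable_restrictT q _)).
exists q'; split => //.
  by move=> u x u0 uM; rewrite q'E// qP// FE lee_fin.
have [m' m'E] := @density_image_exists R _ _ _ _ (@lebesgue_measure R)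
  (\1_(`]0%R, M[%classic)) q' ltac:(by []) ltac:(by []) mq'.
have m'A A : measurable A ->
    m' A = lebesgue_measure (`]0%R, M[%classic `&` q' @^-1` A).
  move=> mA; rewrite -[A in LHS]setIT -integral_indic// m'E//; last first.
    by apply/measurable_EFinP; exact: measurable_indic.
  rewrite -[X in lebesgue_measure X]setIT -integral_indic//; last first.
    by apply: measurableI => //; rewrite -[X in measurable X]setTI; exact: mq'.
  by apply: eq_integral => u _; rewrite indicI/= -EFinM.
suff mm' : forall A, measurable A -> m A = m' A.
  move=> G mG G0; rewrite -m'E//; apply: eq_measure_integral => A mA _.
  exact: mm'.
have M0 : 0 <= M by rewrite -lee_fin -mM.
apply: measure_ray_unique.
- by rewrite mM ltry.
- rewrite m'A// setIT lebesgue_measure_itv/= mM.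
  case: ifPn => [_|]; first by rewrite sube0.
  by rewrite lte_fin -leNgt => M0'; congr EFin; apply/eqP; rewrite eq_le M0 M0'.
- move=> x; rewrite m'A// FE.
  (* The preimage of the ray is []0, F x]] if [F x < M]; if [F x = M] the endpoint falls outside the
     domain and it is []0, M[]. Either way its length is [F x]. *)
  have [FxM|MFx] := ltP (F x) M.
    rewrite (_ : _ `&` _ = `]0, F x]%classic).
      rewrite lebesgue_measure_itv/= lte_fin; case: ifPn => [_|]; first by rewrite sube0.
      by rewrite -leNgt => F0x; congr EFin; apply/eqP; rewrite eq_le F0 F0x.
    apply/seteqP; split => u /=; rewrite !in_itv/=.
      by move=> [/andP[u0 uM]]; rewrite q'E// qP// u0.
    move=> /andP[u0 uF]; have uM := le_lt_trans uF FxM.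
    by rewrite u0 uM; split => //; rewrite q'E// qP.
  have FxE : F x = M by apply/eqP; rewrite eq_le FM MFx.
  rewrite (_ : _ `&` _ = `]0, M[%classic).
    rewrite lebesgue_measure_itv/= lte_fin; case: ifPn => [_|]; first by rewrite sube0 FxE.
    by rewrite -leNgt => F0x; congr EFin; apply/eqP; rewrite FxE eq_le M0 F0x.
  apply/seteqP; split => u /=; rewrite !in_itv/=; first by case.
  move=> /andP[u0 uM]; split; first by rewrite u0.
  by rewrite q'E// qP// FxE ltW.
Qed.

(** * Exchanging mass between paired parameters *)

Lemma measurable_invr (R : realType) d (T : measurableType d) (f : T -> R) :
  measurable_fun setT f -> measurable_fun setT (fun x => (f x)^-1).
Proof.
move=> mf.
(* The square makes the base nonnegative, where the power -1 is the inverse; at 0 both sides are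
   0. *)
have -> : (fun x => (f x)^-1) = (fun x => f x * ((f x ^+ 2) `^ (-1))).
  apply/funext => x; rewrite powR_inv1 ?sqr_ge0//.
  have [->|fx0] := eqVneq (f x) 0; first by rewrite invr0 mul0r.
  by rewrite expr2 invfM mulrA divff// mul1r.
apply: measurable_funM => //.
have mf2 : measurable_fun setT (fun x => f x ^+ 2) by exact: measurable_funX.
have mp : measurable_fun setT ((@powR R) ^~ (-1)) by exact: measurable_powR.
exact: (measurableT_comp mp mf2).
Qed.

Lemma measurable_lt_set (R : realType) d (T : measurableType d) (f g : T -> R) :
  measurable_fun setT f -> measurable_fun setT g ->
  measurable [set x | f x < g x].
Proof.
move=> mf mg; rewrite -[X in measurable X]setTI.
rewrite (_ : [set x | _] = (fun x => f x < g x) @^-1` [set true]).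
  exact: measurable_fun_ltr.
by apply/seteqP; split => x /=.
Qed.

Lemma ge0_integral_weightD (R : realType) d (T : measurableType d)
    (mu : {measure set T -> \bar R}) (v w : T -> R) (K : T -> \bar R) :
  measurable_fun setT v -> measurable_fun setT w -> measurable_fun setT K ->
  (forall x, 0 <= v x) -> (forall x, 0 <= w x) -> (forall x, (0 <= K x)%E) ->
  (\int[mu]_x ((v x)%:E * K x) + \int[mu]_x ((w x)%:E * K x) =
   \int[mu]_x ((v x + w x)%:E * K x))%E.
Proof.
move=> mv mw mK v0 w0 K0; rewrite -ge0_integralD//.
- by apply: eq_integral => x _; rewrite EFinD ge0_muleDl// lee_fin.
- by move=> x _; rewrite mule_ge0// lee_fin.
- by apply: emeasurable_funM => //; exact/measurable_EFinP.
- by move=> x _; rewrite mule_ge0// lee_fin.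
- by apply: emeasurable_funM => //; exact/measurable_EFinP.
Qed.

(** [a] and [b] pair each bit of mass where [f > g] with one where [f < g]. The exchange at [s] is
    tuned so that, above each of the points [f (a s)] and [f (b s)], the mean upward and downward
    displacements agree. The martingale property is stated as equality of these two parts, so that
    only integrals of nonnegative functions occur. *)
Lemma paired_exchange_coupling (R : realType) (I J : set R)
    (f g a b hp hm : R -> R) :
  measurable I -> measurable J ->
  measurable_fun setT f -> measurable_fun setT g ->
  measurable_fun setT a -> measurable_fun setT b ->
  (forall u v, I u -> I v -> u <= v -> f u <= f v) ->
  (forall s, J s -> a s <= b s) ->
  hp = (fun u => \1_I u * Num.max (f u - g u) 0) ->
  hm = (fun u => \1_I u * Num.max (g u - f u) 0) ->
  (forall F : R -> \bar R, measurable_fun setT F -> (forall u, (0 <= F u)%E) ->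
    \int[lebesgue_measure]_s ((\1_J s)%:E * F (a s)) =
    \int[lebesgue_measure]_u ((hp u)%:E * F u))%E ->
  (forall F : R -> \bar R, measurable_fun setT F -> (forall u, (0 <= F u)%E) ->
    \int[lebesgue_measure]_s ((\1_J s)%:E * F (b s)) =
    \int[lebesgue_measure]_u ((hm u)%:E * F u))%E ->
  exists pi : {measure set (R * R) -> \bar R},
    [/\ forall F : R -> \bar R, measurable_fun setT F ->
          (forall x, (0 <= F x)%E) ->
          (\int[pi]_z F z.1 =
           \int[lebesgue_measure]_u ((\1_I u)%:E * F (f u)))%E,
        forall F : R -> \bar R, measurable_fun setT F ->
          (forall x, (0 <= F x)%E) ->
          (\int[pi]_z F z.2 =
           \int[lebesgue_measure]_u ((\1_I u)%:E * F (g u)))%E &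
        forall A : set R, measurable A ->
          (\int[pi]_z (\1_A z.1 * Num.max (z.2 - z.1) 0)%:E =
           \int[pi]_z (\1_A z.1 * Num.max (z.1 - z.2) 0)%:E)%E].
Proof.
move=> mI mJ mf mg ma mb fI ab hpE hmE Ha Hb.
pose mu := @lebesgue_measure R.
have mfa : measurable_fun setT (f \o a) by exact: measurableT_comp.
have mga : measurable_fun setT (g \o a) by exact: measurableT_comp.
have mfb : measurable_fun setT (f \o b) by exact: measurableT_comp.
have mgb : measurable_fun setT (g \o b) by exact: measurableT_comp.
have mhp : measurable_fun setT hp.
  rewrite hpE; apply: measurable_funM; first exact: measurable_indic.
  by apply: measurable_maxr => //; exact: measurable_funB.
have mhm : measurable_fun setT hm.
  rewrite hmE; apply: measurable_funM; first exact: measurable_indic.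
  by apply: measurable_maxr => //; exact: measurable_funB.
have hp0 u : 0 <= hp u by rewrite hpE mulr_ge0// le_max lexx orbT.
have hm0 u : 0 <= hm u by rewrite hmE mulr_ge0// le_max lexx orbT.
have hpP u : 0 < hp u -> I u /\ g u < f u.
  rewrite hpE indicE; case: (boolP (u \in I)) => uI; rewrite ?mul0r ?ltxx// mul1r.
  by rewrite lt_max ltxx orbF subr_gt0; rewrite inE in uI.
have hmP u : 0 < hm u -> I u /\ f u < g u.
  rewrite hmE indicE; case: (boolP (u \in I)) => uI; rewrite ?mul0r ?ltxx// mul1r.
  by rewrite lt_max ltxx orbF subr_gt0; rewrite inE in uI.
have hpV u : 0 < hp u -> hp u = f u - g u.
  move=> h; have [uI gf] := hpP _ h.
  by rewrite hpE indicE mem_set// mul1r; apply/max_idPl; rewrite subr_ge0 ltW.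
have hmV u : 0 < hm u -> hm u = g u - f u.
  move=> h; have [uI gf] := hmP _ h.
  by rewrite hmE indicE mem_set// mul1r; apply/max_idPl; rewrite subr_ge0 ltW.
(* [D] is [J] up to a null set ([aeD]). On it the chain [g (a s) < f (a s) <= f (b s) < g (b s)]
   holds, so all denominators below are positive. *)
pose D := J `&` [set s | 0 < hp (a s)] `&` [set s | 0 < hm (b s)].
have mha : measurable_fun setT (hp \o a) by exact: measurableT_comp.
have mhb : measurable_fun setT (hm \o b) by exact: measurableT_comp.
have mDa : measurable [set s | 0 < hp (a s)] by exact: measurable_lt_set.
have mDb : measurable [set s | 0 < hm (b s)] by exact: measurable_lt_set.
have mD : measurable D by apply: measurableI => //; exact: measurableI.
have DP s : D s -> [/\ g (a s) < f (a s), f (a s) <= f (b s) & f (b s) < g (b s)].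
  move=> [[Js /hpP[Ia ?]] /hmP[Ib ?]]; split => //.
  exact/fI/ab.
(* The image of Lebesgue measure on [J] under [c] has density [h], hence does not charge the set
   where [h] vanishes. *)
have nul (h : R -> R) (c : R -> R) :
    measurable_fun setT h -> (forall u, 0 <= h u) -> measurable_fun setT c ->
    (forall F : R -> \bar R, measurable_fun setT F -> (forall u, (0 <= F u)%E) ->
    \int[lebesgue_measure]_s ((\1_J s)%:E * F (c s)) =
    \int[lebesgue_measure]_u ((h u)%:E * F u))%E ->
    mu.-negligible (J `\` [set s | 0 < h (c s)]).
  move=> mh h0 mc H.
  pose Z := ~` [set u | 0 < h u].
  have mZ : measurable Z by apply: measurableC; exact: measurable_lt_set.
  have mN : measurable (J `\` [set s | 0 < h (c s)]).
    by apply: measurableD => //; apply: measurable_lt_set => //; exact: measurableT_comp.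
  exists (J `\` [set s | 0 < h (c s)]); split => //.
  transitivity (\int[lebesgue_measure]_s (\1_(J `\` [set s | 0 < h (c s)]) s)%:E)%E.
    by rewrite integral_indic// setIT.
  transitivity (\int[lebesgue_measure]_u ((h u)%:E * (\1_Z u)%:E))%E.
    rewrite -(H (EFin \o \1_Z))//=; last by apply/measurable_EFinP; exact: measurable_indic.
    apply: eq_integral => s _; rewrite setDE indicI/= EFinM.
    by congr (_ * (_)%:E)%E; rewrite !indicE; congr (_%:R); congr nat_of_bool;
      apply/idP/idP; rewrite !inE.
  rewrite integral0_eq// => u _; rewrite indicE -EFinM.
  case: (boolP (u \in Z)); last by rewrite mulr0.
  rewrite inE /Z/= => /negP; rewrite -leNgt => hu.
  by rewrite mulr1; congr EFin; apply/eqP; rewrite eq_le hu h0.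
have aeD : {ae mu, forall s, J s -> D s}.
  have : mu.-negligible ((J `\` [set s | 0 < hp (a s)]) `|`
                        (J `\` [set s | 0 < hm (b s)])).
    by apply: negligibleU; exact: nul.
  apply: negligibleS => s /= /not_implyP[Js nDs].
  have [pa|npa] := pselect (0 < hp (a s)); last by left.
  by right; split => // pb; apply: nDs.
have mSp : measurable [set u | 0 < hp u] by exact: measurable_lt_set.
have mSm : measurable [set u | 0 < hm u] by exact: measurable_lt_set.
have DJ s : D s -> J s by case=> -[].
(* Testing the change of variables on [G / h] cancels the density: [ds / h (c s)] is carried to
   Lebesgue measure on the set [h > 0]. Where [h] is 0, the convention that the inverse of 0 is 0
   gives the right value. *)
have tr (h c : R -> R) :
    measurable_fun setT h -> (forall u, 0 <= h u) -> measurable_fun setT c ->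
    (forall s, D s -> 0 < h (c s)) ->
    (forall F : R -> \bar R, measurable_fun setT F -> (forall u, (0 <= F u)%E) ->
    \int[lebesgue_measure]_s ((\1_J s)%:E * F (c s)) =
    \int[lebesgue_measure]_u ((h u)%:E * F u))%E ->
    forall G : R -> \bar R, measurable_fun setT G -> (forall u, (0 <= G u)%E) ->
    (\int[lebesgue_measure]_s ((\1_D s * (h (c s))^-1)%:E * G (c s)) =
    \int[lebesgue_measure]_u ((\1_[set u | (0 < h u)%R] u)%:E * G u))%E.
  move=> mh h0 mc Dh H G mG G0.
  have mhc : measurable_fun setT (h \o c) by exact: measurableT_comp.
  have mGc : measurable_fun setT (G \o c) by exact: measurableT_comp.
  pose G' u := ((h u)^-1%:E * G u)%E.
  have mG' : measurable_fun setT G'.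
    apply: emeasurable_funM => //; apply/measurable_EFinP.
    exact: measurable_invr.
  have G'0 u : (0 <= G' u)%E by rewrite mule_ge0// lee_fin invr_ge0.
  transitivity (\int[lebesgue_measure]_s ((\1_J s)%:E * G' (c s)))%E.
    apply: ge0_ae_eq_integral => //.
    - apply: emeasurable_funM => //; apply/measurable_EFinP.
      apply: measurable_funM; first exact: measurable_indic.
      exact: (@measurable_invr _ _ _ (h \o c)).
    - apply: emeasurable_funM; first by apply/measurable_EFinP; exact: measurable_indic.
      exact: (@measurableT_comp _ _ _ _ _ _ G' _ c).
    - by move=> s _; rewrite mule_ge0// lee_fin mulr_ge0// invr_ge0.
    - by move=> s _; rewrite mule_ge0.
    - move: aeD; apply: negligibleS => s /= nP JD; apply: nP => _; rewrite /G' EFinM -muleA; congr (_ * _)%E.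
      rewrite !indicE; congr (_%:R%:E); congr nat_of_bool.
      by apply/idP/idP; rewrite !inE; [exact: DJ|exact: JD].
  rewrite (H G')//; apply: eq_integral => u _; rewrite /G' muleA -EFinM.
  congr (_%:E * _)%E; have [hu|hu] := pselect (0 < h u).
    by rewrite indicE mem_set// divff// gt_eqF.
  rewrite indicE memNset//.
  have -> : h u = 0 by apply/eqP; rewrite eq_le h0 andbT leNgt; exact/negP.
  by rewrite mul0r.
have tra := tr _ _ mhp hp0 ma (fun s Ds => Ds.1.2) Ha.
have trb := tr _ _ mhm hm0 mb (fun s Ds => Ds.2) Hb.
(* [va s ds] and [vb s ds] are Lebesgue measure on [f > g] and on [f < g]
   transported to the parameter [s]; [w] is the mass that is exchanged. *)
pose w s := \1_D s * (g (b s) - g (a s))^-1.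
pose va s := \1_D s * (hp (a s))^-1.
pose vb s := \1_D s * (hm (b s))^-1.
pose wa s := va s - w s.
pose wb s := vb s - w s.
(* The part of [I] where [f = g]; there the coupling stays on the diagonal. *)
pose S0 := I `\` [set u | 0 < hp u] `\` [set u | 0 < hm u].
have mS0 : measurable S0 by apply: measurableD => //; exact: measurableD.
have mindD : measurable_fun setT (\1_D : R -> R) by exact: measurable_indic.
have mw : measurable_fun setT w.
  apply: measurable_funM => //; apply: measurable_invr.
  exact: measurable_funB.
have mva : measurable_fun setT va.
  by apply: measurable_funM => //; exact: measurable_invr.
have mvb : measurable_fun setT vb.
  by apply: measurable_funM => //; exact: measurable_invr.
have mwa : measurable_fun setT wa by exact: measurable_funB.
have mwb : measurable_fun setT wb by exact: measurable_funB.
have D1 s : D s -> \1_D s = 1 :> R by move=> Ds; rewrite indicE mem_set.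
have D0 s : ~ D s -> \1_D s = 0 :> R by move=> Ds; rewrite indicE memNset.
have w0 s : 0 <= w s.
  have [Ds|nDs] := pselect (D s); last by rewrite /w D0// mul0r.
  rewrite /w D1// mul1r invr_ge0 subr_ge0.
  have [gf ff fg] := DP _ Ds.
  exact: le_trans (ltW gf) (le_trans ff (ltW fg)).
(* There is enough mass left at [a s]: [f (a s) - g (a s)] is at most [g (b s) - g (a s)], and
   inversion reverses the order. [wb0] is the mirror image. *)
have wa0 s : 0 <= wa s.
  have [Ds|nDs] := pselect (D s); last by rewrite /wa /va /w D0// !mul0r subr0.
  have [gf ff fg] := DP _ Ds.
  rewrite /wa /va /w D1// !mul1r subr_ge0 hpV; last exact: Ds.1.2.
  rewrite lef_pV2 ?posrE ?subr_gt0//; last exact: lt_trans gf (le_lt_trans ff fg).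
  by rewrite lerD2r (le_trans ff)// ltW.
have wb0 s : 0 <= wb s.
  have [Ds|nDs] := pselect (D s); last by rewrite /wb /vb /w D0// !mul0r subr0.
  have [gf ff fg] := DP _ Ds.
  rewrite /wb /vb /w D1// !mul1r subr_ge0 hmV; last exact: Ds.2.
  rewrite lef_pV2 ?posrE ?subr_gt0//; last exact: lt_trans gf (le_lt_trans ff fg).
  by rewrite lerD2l lerN2 (le_trans (ltW gf)).
have S0ge u : 0 <= (\1_S0 u : R) by [].
have mindS0 : measurable_fun setT (\1_S0 : R -> R) by exact: measurable_indic.
(* [m0] is the diagonal part, [m1] and [m3] carry the exchanged mass, from [a s] to [b s] and back,
   and [m2] and [m4] the mass left at [a s] and at [b s]. *)
have [m0 m0E] := density_image_exists _ _ _ _ _ lebesgue_measure _ _ mindS0 S0ge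
  (measurable_fun_pair mf mg).
have [m1 m1E] := density_image_exists _ _ _ _ _ lebesgue_measure _ _ mw w0
  (measurable_fun_pair mfa mgb).
have [m2 m2E] := density_image_exists _ _ _ _ _ lebesgue_measure _ _ mwa wa0
  (measurable_fun_pair mfa mga).
have [m3 m3E] := density_image_exists _ _ _ _ _ lebesgue_measure _ _ mw w0
  (measurable_fun_pair mfb mga).
have [m4 m4E] := density_image_exists _ _ _ _ _ lebesgue_measure _ _ mwb wb0
  (measurable_fun_pair mfb mgb).
pose pi := measure_add m0 (measure_add (measure_add m1 m2) (measure_add m3 m4)).
have piE F : measurable_fun setT F -> (forall z, (0 <= F z)%E) ->
  (\int[pi]_z F z = \int[lebesgue_measure]_u ((\1_S0 u)%:E * F (f u, g u)) +
    ((\int[lebesgue_measure]_s ((w s)%:E * F (f (a s), g (b s))) +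
      \int[lebesgue_measure]_s ((wa s)%:E * F (f (a s), g (a s)))) +
     (\int[lebesgue_measure]_s ((w s)%:E * F (f (b s), g (a s))) +
      \int[lebesgue_measure]_s ((wb s)%:E * F (f (b s), g (b s))))))%E.
  by move=> mF F0; rewrite !ge0_integral_measure_add// m0E// m1E// m2E// m3E// m4E.
have wwa s : w s + wa s = va s by rewrite /wa addrC subrK.
have wwb s : w s + wb s = vb s by rewrite /wb addrC subrK.
(* The sets [f = g], [f > g] and [f < g] partition [I]. *)
have split3 (K : R -> \bar R) : measurable_fun setT K -> (forall u, (0 <= K u)%E) ->
   (\int[lebesgue_measure]_u ((\1_S0 u)%:E * K u) +
    (\int[lebesgue_measure]_u ((\1_[set u | (0 < hp u)%R] u)%:E * K u) +
     \int[lebesgue_measure]_u ((\1_[set u | (0 < hm u)%R] u)%:E * K u)) =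
   \int[lebesgue_measure]_u ((\1_I u)%:E * K u))%E.
  move=> mK K0.
  rewrite ge0_integral_weightD//; [|exact: measurable_indic..].
  rewrite ge0_integral_weightD//; last first.
    by apply: measurable_funD; exact: measurable_indic.
  apply: eq_integral => u _; congr (_%:E * _)%E; rewrite !indicE.
  have [hpu|hpu] := pselect (0 < hp u).
    have [Iu gf] := hpP _ hpu.
    have nhm : ~ (0 < hm u) by move=> /hmP[_ /(lt_trans gf)]; rewrite ltxx.
    rewrite [u \in S0]memNset; last by case=> -[].
    rewrite [u \in I]mem_set// [_ \in [set _ | 0 < hp _]]mem_set//.
    by rewrite [_ \in [set _ | 0 < hm _]]memNset// addr0 add0r.
  have [hmu|hmu] := pselect (0 < hm u).
    have [Iu gf] := hmP _ hmu.
    rewrite [u \in S0]memNset; last by case.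
    rewrite [u \in I]mem_set// [_ \in [set _ | 0 < hp _]]memNset//.
    by rewrite [_ \in [set _ | 0 < hm _]]mem_set// !add0r.
  rewrite [_ \in [set _ | 0 < hp _]]memNset// [_ \in [set _ | 0 < hm _]]memNset// !addr0.
  congr (_%:R); congr nat_of_bool; apply/idP/idP; rewrite !inE; first by case=> -[].
  by move=> Iu; split.
have sa (K : R -> \bar R) : measurable_fun setT K -> (forall s, (0 <= K s)%E) ->
  (\int[lebesgue_measure]_s ((w s)%:E * K s) +
   \int[lebesgue_measure]_s ((wa s)%:E * K s) =
   \int[lebesgue_measure]_s ((va s)%:E * K s))%E.
  move=> mK K0; rewrite ge0_integral_weightD//.
  by apply: eq_integral => s _; rewrite wwa.
have sb (K : R -> \bar R) : measurable_fun setT K -> (forall s, (0 <= K s)%E) ->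
  (\int[lebesgue_measure]_s ((w s)%:E * K s) +
   \int[lebesgue_measure]_s ((wb s)%:E * K s) =
   \int[lebesgue_measure]_s ((vb s)%:E * K s))%E.
  move=> mK K0; rewrite ge0_integral_weightD//.
  by apply: eq_integral => s _; rewrite wwb.
have total (K : R -> \bar R) : measurable_fun setT K -> (forall u, (0 <= K u)%E) ->
   (\int[lebesgue_measure]_u ((\1_S0 u)%:E * K u) +
    ((\int[lebesgue_measure]_s ((w s)%:E * K (a s)) +
      \int[lebesgue_measure]_s ((wa s)%:E * K (a s))) +
     (\int[lebesgue_measure]_s ((w s)%:E * K (b s)) +
      \int[lebesgue_measure]_s ((wb s)%:E * K (b s)))) =
   \int[lebesgue_measure]_u ((\1_I u)%:E * K u))%E.
  move=> mK K0; rewrite -split3//; congr (_ + (_ + _))%E.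
    by rewrite -tra// sa//; exact: (measurableT_comp mK ma).
  by rewrite -trb// sb//; exact: (measurableT_comp mK mb).
exists pi; split.
- move=> F mF F0; rewrite (piE (fun z => F z.1))//=; last exact: measurableT_comp.
  exact: (total (F \o f) (measurableT_comp mF mf) (fun u => F0 (f u))).
- move=> F mF F0; rewrite (piE (fun z => F z.2))//=; last exact: measurableT_comp.
  (* For the second coordinate the two exchanged terms trade places: [m3] completes [m2] to the full
     weight [va] at [g (a s)], and [m1] completes [m4] at [g (b s)]. *)
  have rearr (x p q r t : \bar R) :
      (x + ((p + q) + (r + t)) = x + ((r + q) + (p + t)))%E.
    by rewrite (addeC p) addeACA (addeC q).
  rewrite rearr.
  exact: (total (F \o g) (measurableT_comp mF mg) (fun u => F0 (g u))).
- move=> A mA.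
  have mA1 : measurable_fun setT (fun z : R * R => (\1_A z.1 : R)).
    by apply: (@measurableT_comp _ _ _ _ _ _ (\1_A : R -> R) _ fst) => //; exact: measurable_indic.
  rewrite (piE (fun z => (\1_A z.1 * Num.max (z.2 - z.1) 0)%:E)); last 2 first.
  - apply/measurable_EFinP; apply: measurable_funM => //.
    by apply: measurable_maxr => //; exact: measurable_funB.
  - by move=> z; rewrite lee_fin mulr_ge0// le_max lexx orbT.
  rewrite (piE (fun z => (\1_A z.1 * Num.max (z.1 - z.2) 0)%:E)); last 2 first.
  - apply/measurable_EFinP; apply: measurable_funM => //.
    by apply: measurable_maxr => //; exact: measurable_funB.
  - by move=> z; rewrite lee_fin mulr_ge0// le_max lexx orbT.
  congr (_ + _)%E.
    apply: eq_integral => u _ /=; rewrite -!EFinM; congr EFin.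
    have [uS0|uS0] := pselect (S0 u); last by rewrite indicE memNset// !mul0r.
    case: uS0 => -[Iu nhp] nhm.
    have gf : ~ (g u < f u).
      move=> gf; apply: nhp; rewrite /= hpE indicE mem_set// mul1r.
      by rewrite lt_max subr_gt0 gf.
    have fg : ~ (f u < g u).
      move=> fg; apply: nhm; rewrite /= hmE indicE mem_set// mul1r.
      by rewrite lt_max subr_gt0 fg.
    suff -> : f u = g u by [].
    by apply/eqP; rewrite eq_le !leNgt; apply/andP; split; apply/negP.
  (* Each of the four pieces moves in one direction only: [m1] and [m4] upward, [m2] and [m3]
     downward. The other part of its displacement vanishes. *)
  have zero (v : R -> R) (k x y : R -> R) :
      (forall s, ~ D s -> v s = 0) -> (forall s, D s -> x s <= y s) ->
      (\int[lebesgue_measure]_s ((v s)%:E * (k s * Num.max (x s - y s) 0)%:E) = 0)%E.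
    move=> vD xy; rewrite integral0_eq// => s _; rewrite -EFinM; congr EFin.
    have [Ds|nDs] := pselect (D s); last by rewrite vD// mul0r.
    rewrite (_ : Num.max _ _ = 0) ?mulr0//.
    by apply/max_idPr; rewrite subr_le0 xy.
  have wD s : ~ D s -> w s = 0 by move=> Ds; rewrite /w D0// mul0r.
  have waD s : ~ D s -> wa s = 0 by move=> Ds; rewrite /wa /va wD// D0// mul0r subr0.
  have wbD s : ~ D s -> wb s = 0 by move=> Ds; rewrite /wb /vb wD// D0// mul0r subr0.
  have DPl s : D s -> [/\ g (a s) <= f (a s), g (a s) <= f (b s), f (a s) <= g (b s) & f (b s) <= g (b s)].
    move=> /DP[gf ff fg]; split; [exact: ltW | | | exact: ltW].
    - exact: le_trans (ltW gf) ff.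
    - exact: le_trans ff (ltW fg).
  rewrite (zero wa) //=; last by move=> s /DPl[].
  rewrite (zero w _ (g \o a)) //=; last by move=> s /DPl[].
  rewrite (zero w _ (f \o a)) //=; last by move=> s /DPl[].
  rewrite (zero wb _ (f \o b)) //=; last by move=> s /DPl[].
  rewrite adde0 add0e add0e adde0.
  (* Balance at [f (a s)], between [m1] and [m2]: [w (g b - f a) = wa (f a - g a)]. Then at
     [f (b s)], between [m4] and [m3]: [wb (g b - f b) = w (f b - g a)]. *)
  congr (_ + _)%E; apply: eq_integral => s _; rewrite -!EFinM; congr EFin.
    have [Ds|nDs] := pselect (D s); last by rewrite wD// waD// !mul0r.
    have [? ? ? ?] := DPl _ Ds; have [gf ff fg] := DP _ Ds.
    have gfE : f (a s) - g (a s) != 0 by rewrite subr_eq0 gt_eqF.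
    have ggE : g (b s) - g (a s) != 0 by rewrite subr_eq0 gt_eqF// (lt_trans gf)// (le_lt_trans ff).
    rewrite /wa /va /w hpV ?D1//; last exact: Ds.1.2.
    rewrite !(max_idPl _) ?subr_ge0// !mul1r.
    by field; rewrite gfE ggE.
  have [Ds|nDs] := pselect (D s); last by rewrite wD// wbD// !mul0r.
  have [? ? ? ?] := DPl _ Ds; have [gf ff fg] := DP _ Ds.
  have gfE : g (b s) - f (b s) != 0 by rewrite subr_eq0 gt_eqF.
  have ggE : g (b s) - g (a s) != 0 by rewrite subr_eq0 gt_eqF// (lt_trans gf)// (le_lt_trans ff).
  rewrite /wb /vb /w hmV ?D1//; last exact: Ds.2.
  rewrite !(max_idPl _) ?subr_ge0// !mul1r.
  by field; rewrite gfE ggE.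
Qed.

(** * Strassen's theorem on the line *)

(** As [w] is nonnegative it passes through positive and negative parts, so both sides are
    differences of the same two nonnegative integrals, finite or not. *)
Lemma integral_density_image (R : realType) d1 d2 (T1 : measurableType d1)
    (T2 : measurableType d2) (mu : {measure set T1 -> \bar R})
    (m : {measure set T2 -> \bar R}) (w : T1 -> R) (phi : T1 -> T2) :
  (forall x, 0 <= w x) ->
  (forall F : T2 -> \bar R, measurable_fun setT F -> (forall y, (0 <= F y)%E) ->
    \int[m]_y F y = \int[mu]_x ((w x)%:E * F (phi x)))%E ->
  forall F : T2 -> R, measurable_fun setT F ->
    (\int[m]_y (F y)%:E = \int[mu]_x (w x * F (phi x))%:E)%E.
Proof.
move=> w0 H F mF; have mEF : measurable_fun setT (EFin \o F) by exact/measurable_EFinP.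
rewrite integralE [RHS]integralE !H//; last 2 first.
- exact: measurable_funeneg.
- exact: measurable_funepos.
congr (_ - _)%E; apply: eq_integral => x _.
  by rewrite !funeposE -!EFin_max -EFinM maxr_pMr// mulr0.
by rewrite !funenegE -!EFinN -!EFin_max -EFinM maxr_pMr// mulr0 mulrN.
Qed.

Section unit_mass_measure.
Context (R : realType) d (T : measurableType d).
Variables (m : {measure set T -> \bar R}) (mT : m setT = 1%E).

(** The proof of unit mass is an argument of the alias, so that the probability structure can be
    attached to it. *)
Definition unit_mass_measure of m setT = 1%E : set T -> \bar R := m.

HB.instance Definition _ := Measure.on (unit_mass_measure mT).

HB.instance Definition _ :=
  Measure_isProbability.Build _ _ _ (unit_mass_measure mT) mT.

End unit_mass_measure.

(** Equal means together with the inequality on [(t - x)^+] amount to the convex order of [mu] and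
    [nu]. They yield the ordered pairing [a <= b] that the exchange coupling requires. *)
Lemma convex_order_coupling (R : realType) (mu nu : probability R R) :
  mu.-integrable setT (EFin : R -> \bar R) ->
  nu.-integrable setT (EFin : R -> \bar R) ->
  (\int[mu]_x x%:E = \int[nu]_x x%:E)%E ->
  (forall t, \int[mu]_x (Num.max (t - x) 0)%:E <=
             \int[nu]_x (Num.max (t - x) 0)%:E)%E ->
  exists pi : probability (R * R)%type R,
    [/\ forall A : set R, measurable A -> pi (fst @^-1` A) = mu A,
        forall A : set R, measurable A -> pi (snd @^-1` A) = nu A &
        forall A : set R, measurable A ->
          (\int[pi]_z (\1_A z.1 * Num.max (z.2 - z.1) 0)%:E =
           \int[pi]_z (\1_A z.1 * Num.max (z.1 - z.2) 0)%:E)%E].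
Proof.
move=> imu inu mean cvx.
have [f [mf fP Hf]] := quantile_exists _ mu 1 (probability_setT mu).
have [g [mg gP Hg]] := quantile_exists _ nu 1 (probability_setT nu).
pose I : set R := `]0, 1[%classic.
have mI : measurable I by exact: measurable_itv.
have mindI : measurable_fun setT (\1_I : R -> R) by exact: measurable_indic.
have mono (m : probability R R) (q : R -> R) :
    (forall u x, 0 < u -> u < 1 -> (q u <= x) = (u%:E <= m `]-oo, x]%classic)%E) ->
    forall u v, I u -> I v -> u <= v -> q u <= q v.
  move=> qP u v; rewrite /I/= !in_itv/= => /andP[u0 u1] /andP[v0 v1] uv.
  by rewrite qP//; apply: (@le_trans _ _ v%:E); rewrite ?lee_fin// -qP.
have fI := mono _ _ fP; have gI := mono _ _ gP.
pose hp u := \1_I u * Num.max (f u - g u) 0.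
pose hm u := \1_I u * Num.max (g u - f u) 0.
pose F1 u := \1_I u * f u.
pose G1 u := \1_I u * g u.
have mF1 : measurable_fun setT F1 by exact: measurable_funM.
have mG1 : measurable_fun setT G1 by exact: measurable_funM.
have mhp : measurable_fun setT hp.
  by apply: measurable_funM => //; apply: measurable_maxr => //; exact: measurable_funB.
have mhm : measurable_fun setT hm.
  by apply: measurable_funM => //; apply: measurable_maxr => //; exact: measurable_funB.
have hp0 u : 0 <= hp u by rewrite mulr_ge0// le_max lexx orbT.
have hm0 u : 0 <= hm u by rewrite mulr_ge0// le_max lexx orbT.
have I0 u : 0 <= \1_I u :> R by [].
have ifg (m : probability R R) (q : R -> R) : measurable_fun setT q ->
    m.-integrable setT (EFin : R -> \bar R) ->
    (forall F : R -> \bar R, measurable_fun setT F -> (forall y, (0 <= F y)%E) ->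
      (\int[m]_y F y = \int[lebesgue_measure]_u ((\1_I u)%:E * F (q u)))%E) ->
    lebesgue_measure.-integrable setT (fun u => (\1_I u * q u)%:E).
  move=> mq /integrableP[_ im] Hq; apply/integrableP; split.
    by apply/measurable_EFinP; exact: measurable_funM.
  apply: le_lt_trans im; rewrite (Hq (fun x => `|x%:E|%E))//; last first.
    exact: measurableT_comp.
  rewrite le_eqVlt; apply/orP; left; apply/eqP.
  by apply: eq_integral => u _; rewrite -!EFinM/= normrM ger0_norm.
have iF1 := ifg _ _ mf imu Hf.
have iG1 := ifg _ _ mg inu Hg.
have hpmE u : hp u - hm u = F1 u - G1 u.
  rewrite /hp /hm /F1 /G1 -!mulrBr; congr (_ * _).
  by have [fg|gf] := leP (f u) (g u); [rewrite (max_idPr _) ?(max_idPl _) ?subr_ge0 ?subr_le0//|rewrite (max_idPl _) ?(max_idPr _) ?subr_ge0 ?subr_le0 ?(ltW gf)//]; lra.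
have habs u : hp u + hm u = `|F1 u - G1 u|.
  rewrite /hp /hm /F1 /G1 -mulrBr -mulrDr normrM ger0_norm//; congr (_ * _).
  have [fg|gf] := leP (f u) (g u).
    by rewrite (max_idPr _) ?(max_idPl _) ?subr_ge0 ?subr_le0// ler0_norm ?subr_le0//; lra.
  by rewrite (max_idPl _) ?(max_idPr _) ?subr_ge0 ?subr_le0 ?(ltW gf)// ger0_norm ?subr_ge0 ?(ltW gf)//; lra.
have iFG : lebesgue_measure.-integrable setT (fun u => (F1 u - G1 u)%:E).
  by under eq_fun do rewrite EFinB; exact: integrableB.
have ihp : lebesgue_measure.-integrable setT (EFin \o hp).
  apply: (le_integrable measurableT _ _ iFG); first exact/measurable_EFinP.
  by move=> u _ /=; rewrite lee_fin -habs ger0_norm// lerDl.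
have ihm : lebesgue_measure.-integrable setT (EFin \o hm).
  apply: (le_integrable measurableT _ _ iFG); first exact/measurable_EFinP.
  by move=> u _ /=; rewrite lee_fin -habs ger0_norm// lerDr.
have [al alE] := density_image_exists _ _ _ _ _ lebesgue_measure _ _ mhp hp0
  (@measurable_id _ R setT).
have [be beE] := density_image_exists _ _ _ _ _ lebesgue_measure _ _ mhm hm0
  (@measurable_id _ R setT).
have setE (m : {measure set R -> \bar R}) (h : R -> R) :
    (forall F : R -> \bar R, measurable_fun setT F -> (forall y, (0 <= F y)%E) ->
      (\int[m]_y F y = \int[lebesgue_measure]_u ((h u)%:E * F u))%E) ->
    forall X : set R, measurable X ->
    (m X = \int[lebesgue_measure]_(u in X) (h u)%:E)%E.
  move=> mE X mX; rewrite -[X in m X]setIT -integral_indic// mE//; last first.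
    by apply/measurable_EFinP; exact: measurable_indic.
  rewrite [RHS]integral_mkcond; apply: eq_integral => u _.
  by rewrite /patch indicE -EFinM; case: ifPn => _; rewrite ?mulr1 ?mulr0.
have alX := setE _ _ alE; have beX := setE _ _ beE.
have fin (h : R -> R) (X : set R) : lebesgue_measure.-integrable setT (EFin \o h) ->
    measurable X -> (\int[lebesgue_measure]_(u in X) (h u)%:E)%E \is a fin_num.
  move=> ih mX; apply: integrable_fin_num => //.
  exact: (integrableS measurableT).
(* [al X - be X] is the integral of [F1 - G1] over [X], written additively to stay clear of infinite
   differences. *)
have diff X : measurable X -> (al X + \int[lebesgue_measure]_(u in X) (G1 u)%:E =
    be X + \int[lebesgue_measure]_(u in X) (F1 u)%:E)%E.
  move=> mX; rewrite alX// beX// -!integralD_EFin//; try exact: (integrableS measurableT).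
  apply: eq_integral => u _; congr EFin; move: (hpmE u); lra.
have meanE : (\int[lebesgue_measure]_u (F1 u)%:E = \int[lebesgue_measure]_u (G1 u)%:E)%E.
  have Ef := integral_density_image _ _ _ _ _ lebesgue_measure _ _ _ I0 Hf id.
  have Eg := integral_density_image _ _ _ _ _ lebesgue_measure _ _ _ I0 Hg id.
  by rewrite -Ef// -Eg.
have albeT : al setT = be setT.
  have zfin := fin _ _ iG1 measurableT.
  have := diff _ measurableT; rewrite meanE => e.
  by rewrite -(addeK (al setT) zfin) e addeK.
(* For [x <= 0] both sides are 0, and for [x >= 1] they are the two means. Only [0 < x < 1] uses the
   inequality on [(t - x)^+]. *)
have ray x : (\int[lebesgue_measure]_(u in `]-oo, x]) (G1 u)%:E <=
              \int[lebesgue_measure]_(u in `]-oo, x]) (F1 u)%:E)%E.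
  have [x0|x0] := leP x 0.
    rewrite !integral0_eq// => u /=; rewrite in_itv/= => ux; congr EFin;
      by rewrite /F1 /G1 indicE memNset ?mul0r// /I/= in_itv/= ltNge (le_trans ux).
  have [x1|x1] := leP 1 x.
    have whole (q : R -> R) : (\int[lebesgue_measure]_(u in `]-oo, x]) (\1_I u * q u)%:E =
         \int[lebesgue_measure]_u (\1_I u * q u)%:E)%E.
      rewrite integral_mkcond; apply: eq_integral => u _; rewrite /patch.
      case: ifPn => //; rewrite notin_setE/= in_itv/= => /negP; rewrite -ltNge => xu.
      rewrite indicE memNset ?mul0r// /I/= in_itv/= => /andP[_].
      by rewrite ltNge (le_trans x1 (ltW xu)).
    by rewrite !whole -/F1 -/G1 meanE.
  (* At [t = g x], the integral over [u < x] of [t - g] is that of [(t - g)^+]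
     over (0, 1), whereas for [f] it is only bounded above by it. *)
  pose t := g x.
  have Ix : I x by rewrite /I/= in_itv/= x0 x1.
  have iIt : lebesgue_measure.-integrable setT (fun u => (\1_I u * t)%:E).
    under eq_fun do rewrite EFinM; apply: integrableZr => //.
    exact: integrable_indic_itv.
  have pos (q : R -> R) (m : probability R R) : measurable_fun setT q ->
      (forall F : R -> \bar R, measurable_fun setT F -> (forall y, (0 <= F y)%E) ->
      (\int[m]_y F y = \int[lebesgue_measure]_u ((\1_I u)%:E * F (q u)))%E) ->
      (\int[m]_y (Num.max (t - y) 0)%:E =
       \int[lebesgue_measure]_u (\1_I u * Num.max (t - q u) 0)%:E)%E.
    move=> mq -> //.
    - by apply/measurable_EFinP; apply: measurable_maxr => //; exact: measurable_funB.
    - by move=> y; rewrite lee_fin le_max lexx orbT.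
  have mpos (q : R -> R) : measurable_fun setT q ->
      measurable_fun setT (fun u => (\1_I u * Num.max (t - q u) 0)%:E).
    move=> mq; apply/measurable_EFinP; apply: measurable_funM => //.
    by apply: measurable_maxr => //; exact: measurable_funB.
  have key : (\int[lebesgue_measure]_(u in `]-oo, x]) (\1_I u * t - F1 u)%:E <=
              \int[lebesgue_measure]_(u in `]-oo, x]) (\1_I u * t - G1 u)%:E)%E.
    apply: (@le_trans _ _ (\int[lebesgue_measure]_u (\1_I u * Num.max (t - f u) 0)%:E)%E).
      apply: (@le_trans _ _ (\int[lebesgue_measure]_(u in `]-oo, x]) (\1_I u * Num.max (t - f u) 0)%:E)%E).
        have iA : lebesgue_measure.-integrable `]-oo, x] (fun u => (\1_I u * t - F1 u)%:E).
          apply: (integrableS measurableT) => //.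
          by under eq_fun do rewrite EFinB; exact: integrableB.
        rewrite (_ : (\int[lebesgue_measure]_(u in _) (\1_I u * Num.max _ _)%:E =
           \int[lebesgue_measure]_(u in `]-oo, x])
             ((fun u => (\1_I u * t - F1 u)%:E)^\+ u))%E); last first.
          apply: eq_integral => u _.
          by rewrite funeposE -EFin_max /F1 -mulrBr -[in RHS](mulr0 (\1_I u)) -maxr_pMr.
        apply: le_integral => //; first exact: integrable_funepos.
        by move=> u _; rewrite funeposE le_max lexx.
      apply: ge0_subset_integral => //; first exact: mpos.
      by move=> u _; rewrite lee_fin mulr_ge0// le_max lexx orbT.
    rewrite -(pos _ mu)//; apply: (le_trans (cvx t)); rewrite (pos g)//.
    rewrite [leRHS]integral_mkcond le_eqVlt; apply/orP; left; apply/eqP.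
    apply: eq_integral => u _; rewrite /patch /G1 -mulrBr indicE.
    have [Iu|nIu] := pselect (I u); last first.
      by rewrite memNset// !mul0r; case: ifP.
    rewrite mem_set// !mul1r; case: ifPn; rewrite ?inE ?notin_setE/= in_itv/=.
      move=> ux; congr EFin; apply/max_idPl; rewrite subr_ge0; exact: gI.
    move=> /negP; rewrite -ltNge => xu; congr EFin; apply/max_idPr.
    by rewrite subr_le0; apply: gI => //; exact: ltW.
  have iS (h : R -> \bar R) : lebesgue_measure.-integrable setT h ->
      lebesgue_measure.-integrable `]-oo, x] h by exact: (integrableS measurableT).
  move: key; rewrite !integralB_EFin//; try exact: iS.
  by rewrite leeD2lE ?leeN2//; exact: (fin (fun u => \1_I u * t)).
have beal x : (be `]-oo, x]%classic <= al `]-oo, x]%classic)%E.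
  rewrite -(leeD2rE _ _ (fin _ `]-oo, x]%classic iG1 _))// diff//.
  by apply: leeD2l; exact: ray.
(* Equality of the means gives [al] and [be] the same total mass, so [a] and [b] share the parameter
   interval [J]. *)
have alM : al setT = (fine (al setT))%:E by rewrite fineK// alX// fin.
have beM : be setT = (fine (al setT))%:E by rewrite -albeT.
have [a [ma aP Ha]] := quantile_exists _ _ _ alM.
have [b [mb bP Hb]] := quantile_exists _ _ _ beM.
pose J : set R := `]0, fine (al setT)[%classic.
have mJ : measurable J by exact: measurable_itv.
(* The larger distribution function has the smaller quantile function. *)
have ab s : J s -> a s <= b s.
  rewrite /J/= in_itv/= => /andP[s0 sM].
  by rewrite aP//; apply: le_trans (beal _); rewrite -bP.
have [pi [pi1 pi2 pi3]] := paired_exchange_coupling _ I J f g a b hp hm mI mJ mf mg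
  ma mb fI ab erefl erefl (fun F mF F0 => esym (etrans (esym (alE F mF F0)) (Ha F mF F0)))
  (fun F mF F0 => esym (etrans (esym (beE F mF F0)) (Hb F mF F0))).
have marg (p : R * R -> R) (q : R -> R) (m : probability R R) : measurable_fun setT p ->
    (forall F : R -> \bar R, measurable_fun setT F -> (forall x, (0 <= F x)%E) ->
      (\int[pi]_z F (p z) = \int[lebesgue_measure]_u ((\1_I u)%:E * F (q u)))%E) ->
    (forall F : R -> \bar R, measurable_fun setT F -> (forall y, (0 <= F y)%E) ->
      (\int[m]_y F y = \int[lebesgue_measure]_u ((\1_I u)%:E * F (q u)))%E) ->
    forall A : set R, measurable A -> pi (p @^-1` A) = m A.
  move=> mp Hp Hm A mA.
  have mpA : measurable (p @^-1` A) by rewrite -[X in measurable X]setTI; exact: mp.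
  have mEA : measurable_fun setT (EFin \o (\1_A : R -> R)).
    by apply/measurable_EFinP; exact: measurable_indic.
  have A0 y : (0 <= (EFin \o (\1_A : R -> R)) y)%E by rewrite lee_fin.
  rewrite -[A in m A]setIT -integral_indic//.
  rewrite -[X in pi X]setIT -integral_indic//.
  rewrite (Hm (EFin \o \1_A))// -(Hp (EFin \o \1_A))//.
have marg1 := marg _ _ _ measurable_fst pi1 Hf.
have marg2 := marg _ _ _ measurable_snd pi2 Hg.
have piT : pi setT = 1%E by rewrite -(probability_setT mu) -marg1// preimage_setT.
by exists (unit_mass_measure _ _ _ pi piT); split.
Qed.

(** * Integrated distribution functions, integrability, joint laws *)

(** Tonelli on the region [x <= u <= t]: its section at fixed [x] is [[x, t]], of length
    [(t - x)^+]. This translates second-order dominance into the convex order. *)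
Lemma integral_ray_measure (R : realType) (mu : probability R R) (t : R) :
  (\int[lebesgue_measure]_(u in `]-oo, t]) mu `]-oo, u]%classic =
   \int[mu]_x (Num.max (t - x) 0)%:E)%E.
Proof.
pose E : set (measurableTypeR R * R)%type :=
  [set z | z.2 <= z.1] `&` [set z | z.1 <= t].
have mle (p q : measurableTypeR R * R -> R) :
    measurable_fun setT p -> measurable_fun setT q ->
    measurable [set z | p z <= q z].
  move=> mp mq; rewrite (_ : [set z | _] = ~` [set z | q z < p z]).
    by apply: measurableC; exact: measurable_lt_set.
  by apply/seteqP; split => z /=; rewrite leNgt => /negP.
have mE : measurable E.
  by apply: measurableI; apply: mle => //; exact: measurable_cst.
have mEE : measurable_fun setT (EFin \o (\1_E : _ -> R)).
  by apply/measurable_EFinP; exact: measurable_indic.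
have E0 z : (0 <= (EFin \o (\1_E : _ -> R)) z)%E by rewrite lee_fin.
have := @fubini_tonelli _ _ _ _ _ lebesgue_measure mu _ mEE E0.
rewrite /= => fub.
transitivity (\int[lebesgue_measure]_u \int[mu]_y (\1_E (u, y))%:E)%E.
  rewrite integral_mkcond; apply: eq_integral => u _; rewrite /patch.
  case: ifPn => [|nut].
    rewrite inE/= in_itv/= => ut.
    rewrite -[X in mu X]setIT -integral_indic//.
    apply: eq_integral => y _; congr EFin; rewrite !indicE; congr (_%:R); congr nat_of_bool.
    by apply/idP/idP; rewrite !inE /E/= in_itv/=; [move=> yu; split | case].
  rewrite integral0_eq// => y _; rewrite indicE memNset//.
  by case => _ /= ut; move: nut; rewrite notin_setE/= in_itv/=.
rewrite fub; apply: eq_integral => x _.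
transitivity (lebesgue_measure (`[x, t]%classic : set R)).
  rewrite -[X in lebesgue_measure X]setIT -integral_indic//.
  apply: eq_integral => y _; congr EFin; rewrite !indicE; congr (_%:R); congr nat_of_bool.
  by apply/idP/idP; rewrite !inE /E/= in_itv/=; [case => -> ->|move=> /andP[]; split].
rewrite lebesgue_measure_itv/= lte_fin; case: ltP => [xt|tx].
  by rewrite -EFinB; congr EFin; apply/esym/max_idPl; rewrite subr_ge0 ltW.
by congr EFin; apply/esym/max_idPr; rewrite subr_le0.
Qed.

(** If either part had infinite integral, the difference would be infinite too, including for
    [oo - oo] by convention. Hence the noises, known only to have mean 0, are integrable. *)
Lemma integral_fin_num_integrable (R : realType) d (T : measurableType d)
    (mu : {measure set T -> \bar R}) (f : T -> \bar R) :
  measurable_fun setT f -> (\int[mu]_x f x)%E \is a fin_num ->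
  mu.-integrable setT f.
Proof.
move=> mf; rewrite integralE => fin; apply/integrableP; split => //.
have p0 : (0 <= \int[mu]_x f^\+ x)%E by exact: integral_ge0.
have n0 : (0 <= \int[mu]_x f^\- x)%E by exact: integral_ge0.
rewrite -(_ : (fun x => f^\+ x + f^\- x)%E = (fun x => `|f x|)%E); last first.
  exact/esym/fune_abse.
rewrite ge0_integralD//; [|exact: measurable_funepos|exact: measurable_funeneg].
move: fin p0 n0; case: (\int[mu]_x f^\+ x)%E => [p| |] //;
  by case: (\int[mu]_x f^\- x)%E => [n| |] //=; rewrite ?ltry.
Qed.

Lemma eq_distribution_integrable (R : realType) d1 (T1 : measurableType d1)
    d2 (T2 : measurableType d2) (P1 : probability T1 R) (P2 : probability T2 R)
    (X1 : {RV P1 >-> R}) (X2 : {RV P2 >-> R}) :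
  eq_distribution X1 X2 -> P1.-integrable setT (EFin \o X1) ->
  P2.-integrable setT (EFin \o X2).
Proof.
move=> X12 /integrableP[_ iX]; apply/integrableP; split.
  exact/measurable_EFinP.
apply: le_lt_trans iX; rewrite le_eqVlt; apply/orP; left; apply/eqP.
have m1 : measurable_fun setT (fun x : R => `|x%:E|%E) by exact: measurableT_comp.
transitivity (\int[distribution P1 X1]_x `|x%:E|)%E; last first.
  exact: ge0_integral_distribution.
rewrite (eq_measure_integral (distribution P2 X2)); last by move=> A mA _; exact: X12.
by rewrite [RHS]ge0_integral_distribution.
Qed.

Lemma eq_distribution_integral (R : realType) d1 (T1 : measurableType d1)
    d2 (T2 : measurableType d2) (P1 : probability T1 R) (P2 : probability T2 R)
    (X1 : {RV P1 >-> R}) (X2 : {RV P2 >-> R}) :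
  eq_distribution X1 X2 -> P1.-integrable setT (EFin \o X1) ->
  (\int[P1]_x (X1 x)%:E = \int[P2]_x (X2 x)%:E)%E.
Proof.
move=> X12 iX1; have iX2 := eq_distribution_integrable _ _ _ _ _ _ _ _ _ X12 iX1.
rewrite -(integral_distribution (f := EFin))//.
rewrite (eq_measure_integral (distribution P2 X2)); last by move=> A mA _; exact: X12.
exact: integral_distribution.
Qed.

(** Independence is this identity on rectangles, which determine the product measure. *)
Lemma independent_joint_law (R : realType) d (T : measurableType d)
    (P : probability T R) (X Z : {RV P >-> R}) :
  independent_rv X Z -> forall E : set (R * R), measurable E ->
  P ((fun x => (X x, Z x)) @^-1` E) =
  (distribution P X \x distribution P Z)%E E.
Proof.
move=> XZ E mE.
have mXZ : measurable_fun setT (fun x => (X x, Z x)) by exact: measurable_fun_pair.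
pose XZm : {mfun T >-> (R * R)%type} :=
  HB.pack (fun x => (X x, Z x)) (isMeasurableFun.Build _ _ _ _ _ mXZ).
by apply/esym; apply: (product_measure_unique (m' := distribution P XZm)).
Qed.

(** Applied to the two projections of the coupling, this reduces each noise plus the copy of [psi]
    to a product of two laws. It suffices to check rectangles. *)
Lemma product_map_law (R : realType) d1 (T1 : measurableType d1)
    d2 (T2 : measurableType d2) (pi : probability T1 R) (rho : probability T2 R)
    (mu : probability R R) (p : T1 -> R) :
  measurable_fun setT p ->
  (forall A, measurable A -> pi (p @^-1` A) = mu A) ->
  forall E : set (R * T2), measurable E ->
  (pi \x rho)%E ((fun z => (p z.1, z.2)) @^-1` E) = (mu \x rho)%E E.
Proof.
move=> mp pimu E mE.
have mq : measurable_fun setT (fun z : T1 * T2 => (p z.1, z.2)).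
  apply: measurable_fun_pair => //.
  exact: (measurableT_comp mp measurable_fst).
pose q : {mfun (T1 * T2)%type >-> (R * T2)%type} :=
  HB.pack (fun z : T1 * T2 => (p z.1, z.2)) (isMeasurableFun.Build _ _ _ _ _ mq).
apply/esym; apply: (product_measure_unique (m' := distribution (pi \x rho)%E q)) => //.
move=> A B mA mB.
rewrite /distribution /pushforward/=.
rewrite (_ : _ @^-1` _ = (p @^-1` A) `*` B)//.
have mpA : measurable (p @^-1` A) by rewrite -[X in measurable X]setTI; exact: mp.
rewrite product_measure1E//; congr (_ * _)%E; exact: pimu.
Qed.

(** * Adding an independent copy of [psi] to the coupling *)

Theorem proposition4 (R : realType) (d : measure_display)
    (T : measurableType d) (P : probability T R)
    (Y psi xi_psi xi_Y : {RV P >-> R})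
    (intY : ('E_P[(fun x => `|Y x|%R)] < +oo)%E)
    (intpsi : ('E_P[(fun x => `|psi x|%R)] < +oo)%E)
    (H0 : satisfy_H0 Y psi)
    (indep_psi : independent_rv xi_psi psi)
    (mean_psi : ('E_P[xi_psi] = 0)%E)
    (indep_Y : independent_rv xi_Y Y)
    (mean_Y : ('E_P[xi_Y] = 0)%E) :
  let eps : {RV P >-> R} := Y - psi in
  let hat_psi : {RV P >-> R} := psi + xi_psi in
  let hat_Y : {RV P >-> R} := Y + xi_Y in
  independent_rv (eps + xi_Y : {RV P >-> R}) psi ->
  second_order_dominates (cdf xi_psi) (cdf (xi_Y + eps : {RV P >-> R})) ->
  satisfy_H0 hat_Y hat_psi.
Proof.
move=> eps hat_psi hat_Y indepW dom.
pose W : {RV P >-> R} := eps + xi_Y.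
have WE x : W x = Y x - psi x + xi_Y x by [].
have int1 (X : {RV P >-> R}) : ('E_P[(fun x => `|X x|%R)] < +oo)%E ->
    P.-integrable setT (EFin \o X).
  move=> h; apply/integrableP; split; first exact/measurable_EFinP.
  by move: h; rewrite unlock.
have int2 (X : {RV P >-> R}) : ('E_P[X] = 0)%E ->
    P.-integrable setT (EFin \o X).
  move=> h; apply: integral_fin_num_integrable; first exact/measurable_EFinP.
  by move: h; rewrite unlock => ->.
have iY := int1 _ intY; have ipsi := int1 _ intpsi.
have ixi := int2 _ mean_psi; have ixiY := int2 _ mean_Y.
(* [H0] gives equal means by conditioning on the whole space, an event of [I] as the complement of
   the empty set. *)
have meanYpsi : (\int[P]_x (Y x)%:E = \int[P]_x (psi x)%:E)%E.
  case: H0 => d' [T' [P' [Y' [psi' [I [[sI _] _ eY epsi [iY' ipsi' _ ce]]]]]]].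
  rewrite -(eq_distribution_integral _ _ _ _ _ _ _ _ _ eY iY').
  rewrite -(eq_distribution_integral _ _ _ _ _ _ _ _ _ epsi ipsi').
  apply/esym/ce; case: sI => I0 IC _.
  by have := IC _ I0; rewrite setD0.
have iW : P.-integrable setT (EFin \o W).
  rewrite (_ : EFin \o W = ((EFin \o Y) \- (EFin \o psi)) \+ (EFin \o xi_Y))%E.
    by apply: integrableD => //; exact: integrableB.
  by apply/funext.
have meanW : (\int[P]_x (W x)%:E = 0)%E.
  transitivity (\int[P]_x (((EFin \o Y) x - (EFin \o psi) x) + (EFin \o xi_Y) x))%E.
    exact: eq_integral.
  rewrite integralD//; last exact: integrableB.
  rewrite integralB//= meanYpsi subee ?add0e; last exact: integrable_fin_num.
  by move: mean_Y; rewrite unlock.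
pose mu := distribution P xi_psi.
pose nu := distribution P W.
have iid (X : {RV P >-> R}) : P.-integrable setT (EFin \o X) ->
    (distribution P X).-integrable setT (EFin : R -> \bar R).
  move=> /integrableP[_ iX]; apply/integrableP; split => //.
  by rewrite ge0_integral_distribution//; exact: measurableT_comp.
have meanmn : (\int[mu]_x x%:E = \int[nu]_x x%:E)%E.
  rewrite (integral_distribution (f := EFin))//.
  rewrite (integral_distribution (f := EFin))//= meanW.
  by move: mean_psi; rewrite unlock.
have cvx t : (\int[mu]_x (Num.max (t - x) 0)%:E <=
              \int[nu]_x (Num.max (t - x) 0)%:E)%E.
  rewrite -!integral_ray_measure; have := dom t.
  by rewrite (addrC xi_Y).
have [pi [pi1 pi2 pi3]] := convex_order_coupling _ _ _ (iid _ ixi) (iid _ iW) meanmn cvx.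
pose rho := distribution P psi.
(* A point [((x, w), y)] consists of the coupled values of [xi_psi] and [W] and an independent copy
   [y] of [psi]. *)
pose Q : probability ((R * R) * R)%type R := (pi \x rho)%E.
have m11 : measurable_fun setT (fun z : (R * R) * R => z.1.1).
  exact: (measurableT_comp measurable_fst measurable_fst).
have m12 : measurable_fun setT (fun z : (R * R) * R => z.1.2).
  exact: (measurableT_comp measurable_snd measurable_fst).
have mhX : measurable_fun setT (fun z : (R * R) * R => z.2 + z.1.1).
  exact: measurable_funD.
have mhY : measurable_fun setT (fun z : (R * R) * R => z.2 + z.1.2).
  exact: measurable_funD.
pose hX : {RV Q >-> R} := HB.pack (fun z : (R * R) * R => z.2 + z.1.1)
  (isMeasurableFun.Build _ _ _ _ _ mhX).
pose hY : {RV Q >-> R} := HB.pack (fun z : (R * R) * R => z.2 + z.1.2)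
  (isMeasurableFun.Build _ _ _ _ _ mhY).
have mpre B : measurable B -> measurable (hX @^-1` B).
  exact: measurable_funPTI.
have law (p : R * R -> R) (V S : {RV P >-> R}) (h : {RV Q >-> R}) :
    measurable_fun setT p ->
    (forall A, measurable A -> pi (p @^-1` A) = distribution P V A) ->
    independent_rv V psi -> (forall x, S x = psi x + V x) ->
    (forall z, h z = z.2 + p z.1) -> eq_distribution h S.
  move=> mp pip indep SE hE A mA.
  pose E : set (R * R) := (fun z => z.2 + z.1) @^-1` A.
  have mE : measurable E.
    rewrite -[X in measurable X]setTI.
    by apply: (measurable_funD measurable_snd measurable_fst).
  rewrite /distribution /pushforward/=.
  rewrite (_ : h @^-1` A = (fun z => (p z.1, z.2)) @^-1` E); last first.
    by apply/seteqP; split => z; rewrite /E/= hE.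
  rewrite (_ : S @^-1` A = (fun x => (V x, psi x)) @^-1` E); last first.
    by apply/seteqP; split => z; rewrite /E/= SE.
  rewrite independent_joint_law//.
  exact: (product_map_law _ _ _ _ _ pi rho (distribution P V)).
have lX : eq_distribution hX hat_psi.
  exact: (law fst xi_psi hat_psi hX measurable_fst pi1 indep_psi).
have lY : eq_distribution hY hat_Y.
  apply: (law snd W hat_Y hY measurable_snd pi2 indepW) => // x.
  rewrite (_ : hat_Y x = Y x + xi_Y x)// (_ : W x = Y x - psi x + xi_Y x)//; lra.
have ihX : Q.-integrable setT (EFin \o hX).
  apply: (eq_distribution_integrable _ _ _ _ _ P _ hat_psi).
    by move=> A mA; rewrite lX.
  rewrite (_ : EFin \o hat_psi = (EFin \o psi) \+ (EFin \o xi_psi))%E.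
    exact: integrableD.
  by apply/funext.
have ihY : Q.-integrable setT (EFin \o hY).
  apply: (eq_distribution_integrable _ _ _ _ _ P _ hat_Y).
    by move=> A mA; rewrite lY.
  rewrite (_ : EFin \o hat_Y = (EFin \o Y) \+ (EFin \o xi_Y))%E.
    exact: integrableD.
  by apply/funext.
(* Conditioning is on [hX] itself, so the events to test are [hX] in [B] for Borel [B]. *)
exists _, _, Q, hY, hX, (sigma_rv hX); split => //.
- split; first exact/sigma_algebra_preimage/sigma_algebra_measurable.
  move=> _ [B mB <-]; rewrite setTI.
  exact: mpre.
split => // A [B mB <-]; rewrite setTI.
pose A' : set ((R * R) * R) := hX @^-1` B.
have mA' : measurable A' by exact: mpre.
have mdiff : measurable_fun setT (fun z : (R * R) * R => z.1.2 - z.1.1).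
  exact: measurable_funB.
pose dp (z : (R * R) * R) := \1_A' z * Num.max (z.1.2 - z.1.1) 0.
pose dm (z : (R * R) * R) := \1_A' z * Num.max (z.1.1 - z.1.2) 0.
have mdp : measurable_fun setT (EFin \o dp).
  apply/measurable_EFinP; apply: measurable_funM; first exact: measurable_indic.
  exact: measurable_maxr.
have mdm : measurable_fun setT (EFin \o dm).
  apply/measurable_EFinP; apply: measurable_funM; first exact: measurable_indic.
  by apply: measurable_maxr => //; exact: measurable_funB.
have dp0 z : (0 <= (EFin \o dp) z)%E by rewrite lee_fin mulr_ge0// le_max lexx orbT.
have dm0 z : (0 <= (EFin \o dm) z)%E by rewrite lee_fin mulr_ge0// le_max lexx orbT.
(* At fixed [y] the event [hX] in [B] becomes a Borel condition [By] on the first coupled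
   coordinate, to which [pi3] applies; Tonelli then integrates over [y]. *)
have dpm : (\int[Q]_z (dp z)%:E = \int[Q]_z (dm z)%:E)%E.
  rewrite (fubini_tonelli1 _ mdp dp0) (fubini_tonelli _ mdp dp0).
  rewrite (fubini_tonelli1 _ mdm dm0) (fubini_tonelli _ mdm dm0).
  apply: eq_integral => y _ /=.
  pose By : set R := (fun x => y + x) @^-1` B.
  have mBy : measurable By.
    rewrite -[X in measurable X]setTI.
    by apply: (measurable_funD (measurable_cst y) (@measurable_id _ R setT)).
  by have := pi3 By mBy; rewrite /dp /dm /= .
have idiff : Q.-integrable setT (fun z => ((EFin \o hY) z - (EFin \o hX) z))%E.
  exact: integrableB.
(* The copy of [psi] cancels in [hY - hX], whose two parts on [A'] are therefore [dp] and [dm]. *)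
have diff0 : (\int[Q]_(z in A') ((EFin \o hY) z - (EFin \o hX) z) = 0)%E.
  have iA : Q.-integrable A' (fun z => ((EFin \o hY) z - (EFin \o hX) z))%E.
    exact: (integrableS measurableT).
  have pE : (\int[Q]_(z in A') (fun z => ((EFin \o hY) z - (EFin \o hX) z))^\+ z =
             \int[Q]_z (dp z)%:E)%E.
    rewrite integral_mkcond; apply: eq_integral => z _; rewrite /patch /dp indicE.
    case: ifPn => _; rewrite ?mul0r// mul1r funeposE -EFinB -EFin_max.
    by congr (Num.max _ _)%:E; rewrite /hX /hY/=; lra.
  have mE : (\int[Q]_(z in A') (fun z => ((EFin \o hY) z - (EFin \o hX) z))^\- z =
             \int[Q]_z (dm z)%:E)%E.
    rewrite integral_mkcond; apply: eq_integral => z _; rewrite /patch /dm indicE.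
    case: ifPn => _; rewrite ?mul0r// mul1r funenegE -EFinB -EFinN -EFin_max.
    by congr (Num.max _ _)%:E; rewrite /hX /hY/=; lra.
  rewrite integralE pE mE -dpm subee// -pE.
  exact: integrable_pos_fin_num.
have iXA : Q.-integrable A' (EFin \o hX) by exact: (integrableS measurableT).
have iYA : Q.-integrable A' (EFin \o hY) by exact: (integrableS measurableT).
have finX := integrable_fin_num mA' iXA.
by move: diff0; rewrite integralB// => e; rewrite -[RHS](subeK _ finX) e add0e.
Qed.
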